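(* The system $\mathrm{CZF}^-$ augmented with the unrestricted Separation scheme proves that every monotone operator $\Gamma$ on a set-generated $\bigvee$-semilattice $L$ has a least fixed point.
   Context: $\mathrm{CZF}^-$ is the theory in first-order intuitionistic logic with equality, in the language of $\in$, with axioms and schemes: Extensionality; Pair; Union; Restricted Separation (only formulas all of whose quantifiers are of the form $\forall x\in b$, $\exists x\in c$); Infinity; Set Induction ($\forall a((\forall x\in a)\phi(x)\to\phi(a))\to\forall a\,\phi(a)$, for all $\phi$); Strong Collection ($\forall a((\forall x\in a)\exists y\,\phi(x,y)\to\exists b((\forall x\in a)(\exists y\in b)\phi(x,y)\wedge(\forall y\in b)(\exists x\in a)\phi(x,y)))$, for all $\phi$). The unrestricted Separation scheme says that $\{y\in a\mid\phi(y)\}$ is a set for every set $a$ and every formula $\phi$. Classes are given by formulas as usual; subsets are sets. A partially ordered class $(L,\leq)$ is a class with a reflexive, transitive, antisymmetric class relation. It is a $\bigvee$-semilattice if every subset of $L$ has a supremum. A $\bigvee$-semilattice $L$ is set-generated if there is a subset $B$ of $L$ (a generating set) such that for all $x\in L$: (i) $\downarrow^B x=\{b\in B\mid b\leq x\}$ is a set; (ii) $x=\bigvee\downarrow^B x$. A monotone operator on $L$ is a (class) function $\Gamma:L\to L$ such that $a_1\leq a_2$ implies $\Gamma(a_1)\leq\Gamma(a_2)$. *)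

(* Defs.v *)
From Stdlib Require Import List.
Import ListNotations.

(** * Intuitionistic first-order logic with equality in the language of [∈] *)

(** De Bruijn indices.  The language has no function symbols, so the terms are
    the variables and substitution is renaming. *)
Inductive form : Type :=
| Bot : form
| Eq  : nat -> nat -> form
| Mem : nat -> nat -> form
| And : form -> form -> form
| Or  : form -> form -> form
| Imp : form -> form -> form
| All : form -> form
| Ex  : form -> form.

Definition scons (x : nat) (r : nat -> nat) (n : nat) : nat :=
  match n with O => x | S k => r k end.

Fixpoint ren (r : nat -> nat) (p : form) : form :=
  match p with
  | Bot => Bot
  | Eq x y => Eq (r x) (r y)
  | Mem x y => Mem (r x) (r y)
  | And p q => And (ren r p) (ren r q)
  | Or p q => Or (ren r p) (ren r q)
  | Imp p q => Imp (ren r p) (ren r q)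
  | All p => All (ren (scons 0 (fun n => S (r n))) p)
  | Ex p => Ex (ren (scons 0 (fun n => S (r n))) p)
  end.

Definition subst0 (t : nat) (p : form) : form := ren (scons t (fun n => n)) p.

(** Natural deduction from the axioms [T].  The eigenvariable conditions of
    [AllI] and [ExE] concern the hypotheses [H] only: an axiom with free
    variables thus has the force of its universal closure. *)
Inductive prv (T : form -> Prop) : list form -> form -> Prop :=
| Hyp  H p : In p H -> prv T H p
| Ax   H p : T p -> prv T H p
| BotE H p : prv T H Bot -> prv T H p
| AndI H p q : prv T H p -> prv T H q -> prv T H (And p q)
| AndE1 H p q : prv T H (And p q) -> prv T H p
| AndE2 H p q : prv T H (And p q) -> prv T H q
| OrI1 H p q : prv T H p -> prv T H (Or p q)
| OrI2 H p q : prv T H q -> prv T H (Or p q)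
| OrE  H p q r :
    prv T H (Or p q) -> prv T (p :: H) r -> prv T (q :: H) r -> prv T H r
| ImpI H p q : prv T (p :: H) q -> prv T H (Imp p q)
| ImpE H p q : prv T H (Imp p q) -> prv T H p -> prv T H q
| AllI H p : prv T (map (ren S) H) p -> prv T H (All p)
| AllE H p t : prv T H (All p) -> prv T H (subst0 t p)
| ExI  H p t : prv T H (subst0 t p) -> prv T H (Ex p)
| ExE  H p q :
    prv T H (Ex p) -> prv T (p :: map (ren S) H) (ren S q) -> prv T H q
| EqI  H x : prv T H (Eq x x)
| EqE  H p x y : prv T H (Eq x y) -> prv T H (subst0 x p) -> prv T H (subst0 y p).

(** The variable of a bounded quantifier is index [0]; the bound is a
    different variable, hence of the form [S a]. *)
Inductive restricted : form -> Prop :=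
| rBot : restricted Bot
| rEq x y : restricted (Eq x y)
| rMem x y : restricted (Mem x y)
| rAnd p q : restricted p -> restricted q -> restricted (And p q)
| rOr p q : restricted p -> restricted q -> restricted (Or p q)
| rImp p q : restricted p -> restricted q -> restricted (Imp p q)
| rAll a p : restricted p -> restricted (All (Imp (Mem 0 (S a)) p))
| rEx a p : restricted p -> restricted (Ex (And (Mem 0 (S a)) p)).

(** * Writing formulas with named variables *)

(** An [fm] (resp. a [tm]) is a formula (resp. a variable) as a function of the
    number [d] of quantifiers above it.  A variable bound by a quantifier that
    itself lies under [k] quantifiers has index [d - S k] at depth [d]. *)
Definition fm := nat -> form.
Definition tm := nat -> nat.

Definition f_eq (x y : tm) : fm := fun d => Eq (x d) (y d).
Definition f_mem (x y : tm) : fm := fun d => Mem (x d) (y d).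
Definition f_and (p q : fm) : fm := fun d => And (p d) (q d).
Definition f_or (p q : fm) : fm := fun d => Or (p d) (q d).
Definition f_imp (p q : fm) : fm := fun d => Imp (p d) (q d).
Definition f_iff (p q : fm) : fm := f_and (f_imp p q) (f_imp q p).
Definition f_not (p : fm) : fm := f_imp p (fun _ => Bot).
Definition f_all (p : tm -> fm) : fm := fun k => All (p (fun d => d - S k) (S k)).
Definition f_ex (p : tm -> fm) : fm := fun k => Ex (p (fun d => d - S k) (S k)).
Definition f_all_in (a : tm) (p : tm -> fm) : fm :=
  f_all (fun x => f_imp (f_mem x a) (p x)).
Definition f_ex_in (a : tm) (p : tm -> fm) : fm :=
  f_ex (fun x => f_and (f_mem x a) (p x)).

(** [p(args)] under [d] quantifiers: the variables [0, 1, ..., length args - 1]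
    of [p] are its arguments, and its remaining variables are parameters, which
    are shifted past the [d] quantifiers. *)
Definition inst (p : form) (args : list nat) (d : nat) : form :=
  ren (fun n => nth n args (n - length args + d)) p.

Definition app1 (p : form) (x : tm) : fm := fun d => inst p [x d] d.
Definition app2 (p : form) (x y : tm) : fm := fun d => inst p [x d; y d] d.

Definition toplevel (p : fm) : form := p 0.

Declare Scope fm_scope.
Delimit Scope fm_scope with fm.
Bind Scope fm_scope with fm.
Notation "x ≈ y" := (f_eq x y) (at level 70) : fm_scope.
Notation "x ∈ y" := (f_mem x y) (at level 70) : fm_scope.
Notation "¬ p" := (f_not p) (at level 75, right associativity) : fm_scope.
Notation "p ∧ q" := (f_and p q) (at level 80, right associativity) : fm_scope.
Notation "p ∨ q" := (f_or p q) (at level 85, right associativity) : fm_scope.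
Notation "p ⇒ q" := (f_imp p q) (at level 90, right associativity) : fm_scope.
Notation "p ⇔ q" := (f_iff p q) (at level 95) : fm_scope.
Notation "∀ x , p" := (f_all (fun x => p))
  (at level 200, x name, p at level 200) : fm_scope.
Notation "∃ x , p" := (f_ex (fun x => p))
  (at level 200, x name, p at level 200) : fm_scope.
Notation "∀ x 'in' a , p" := (f_all_in a (fun x => p))
  (at level 200, x name, a at level 65, p at level 200) : fm_scope.
Notation "∃ x 'in' a , p" := (f_ex_in a (fun x => p))
  (at level 200, x name, a at level 65, p at level 200) : fm_scope.
Local Open Scope fm_scope.

(** * The theory *)

Definition extensionality : fm :=
  ∀ a, ∀ b, (∀ x, x ∈ a ⇔ x ∈ b) ⇒ a ≈ b.

Definition pair : fm :=
  ∀ a, ∀ b, ∃ c, ∀ x, x ∈ c ⇔ x ≈ a ∨ x ≈ b.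

Definition union : fm :=
  ∀ a, ∃ c, ∀ x, x ∈ c ⇔ ∃ y in a, x ∈ y.

(** There is a set containing [∅] and closed under [x ↦ x ∪ {x}]. *)
Definition infinity : fm :=
  ∃ a, (∃ z in a, ∀ u, ¬ u ∈ z) ∧
       (∀ x in a, ∃ y in a, ∀ u, u ∈ y ⇔ u ∈ x ∨ u ≈ x).

Definition separation (phi : tm -> fm) : fm :=
  ∀ a, ∃ b, ∀ y, y ∈ b ⇔ y ∈ a ∧ phi y.

Definition set_induction (phi : tm -> fm) : fm :=
  (∀ a, (∀ x in a, phi x) ⇒ phi a) ⇒ ∀ a, phi a.

Definition strong_collection (phi : tm -> tm -> fm) : fm :=
  ∀ a, (∀ x in a, ∃ y, phi x y) ⇒
    ∃ b, (∀ x in a, ∃ y in b, phi x y) ∧ (∀ y in b, ∃ x in a, phi x y).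

Inductive CZFm : form -> Prop :=
| ax_ext : CZFm (toplevel extensionality)
| ax_pair : CZFm (toplevel pair)
| ax_union : CZFm (toplevel union)
| ax_rsep p : restricted p -> CZFm (toplevel (separation (app1 p)))
| ax_inf : CZFm (toplevel infinity)
| ax_ind p : CZFm (toplevel (set_induction (app1 p)))
| ax_scoll p : CZFm (toplevel (strong_collection (app2 p))).

Inductive CZFm_Sep : form -> Prop :=
| ax_CZFm p : CZFm p -> CZFm_Sep p
| ax_sep p : CZFm_Sep (toplevel (separation (app1 p))).

(** * Set-generated ⋁-semilattices and monotone operators *)

(** [L x] stands for [x ∈ L].  The relation is [{(x, y) ∈ L × L | le x y}] and
    the operator is [{(x, y) ∈ L × L | G x y}], so that [le] and [G] are only
    ever considered on members of [L].  The formulas defining [L], [le] and [G]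
    may have parameters; these stay free in [lfp_statement], and since a
    derivation without hypotheses can be generalized by [AllI], deriving it
    amounts to deriving its universal closure. *)

Definition po_class (L : tm -> fm) (le : tm -> tm -> fm) : fm :=
  (∀ x, L x ⇒ le x x) ∧
  (∀ x, ∀ y, ∀ z, L x ⇒ L y ⇒ L z ⇒ le x y ⇒ le y z ⇒ le x z) ∧
  (∀ x, ∀ y, L x ⇒ L y ⇒ le x y ⇒ le y x ⇒ x ≈ y).

Definition subset_of (u : tm) (L : tm -> fm) : fm := ∀ x in u, L x.

Definition is_sup (L : tm -> fm) (le : tm -> tm -> fm) (s u : tm) : fm :=
  L s ∧ (∀ y in u, le y s) ∧ (∀ z, L z ⇒ (∀ y in u, le y z) ⇒ le s z).

Definition sup_semilattice (L : tm -> fm) (le : tm -> tm -> fm) : fm :=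
  po_class L le ∧ (∀ u, subset_of u L ⇒ ∃ s, is_sup L le s u).

Definition set_generated (L : tm -> fm) (le : tm -> tm -> fm) : fm :=
  ∃ B, subset_of B L ∧
    (∀ x, L x ⇒
       ∃ d, (∀ b, b ∈ d ⇔ b ∈ B ∧ le b x) ∧ is_sup L le x d).

Definition operator (L : tm -> fm) (G : tm -> tm -> fm) : fm :=
  ∀ x, L x ⇒ ∃ y, (L y ∧ G x y) ∧ (∀ z, L z ⇒ G x z ⇒ z ≈ y).

Definition monotone_operator
    (L : tm -> fm) (le G : tm -> tm -> fm) : fm :=
  operator L G ∧
  (∀ a1, ∀ a2, ∀ b1, ∀ b2, L a1 ⇒ L a2 ⇒ L b1 ⇒ L b2 ⇒
     G a1 b1 ⇒ G a2 b2 ⇒ le a1 a2 ⇒ le b1 b2).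

Definition fixed_point (L : tm -> fm) (G : tm -> tm -> fm) (x : tm) : fm :=
  L x ∧ G x x.

Definition has_least_fixed_point
    (L : tm -> fm) (le G : tm -> tm -> fm) : fm :=
  ∃ x, fixed_point L G x ∧ (∀ y, fixed_point L G y ⇒ le x y).

Definition lfp_statement (L : tm -> fm) (le G : tm -> tm -> fm) : fm :=
  sup_semilattice L le ⇒ set_generated L le ⇒ monotone_operator L le G ⇒
  has_least_fixed_point L le G.

(* Main.v *)
(** Knaster–Tarski with a set of generators instead of all of [L]: unrestricted
    Separation makes [I = {b ∈ B | b ≤ z for all z with Γ z ≤ z}] a set, although
    the [z] range over a class.  Then [x = ⋁ I] lies below every prefixed [z], so
    [Γ x ≤ Γ z ≤ z]; hence every generator below [Γ x] is in [I], and [Γ x ≤ x].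
    Thus [Γ x] is prefixed too, which gives [x ≤ Γ x]. *)

From Stdlib Require Import List PeanoNat Lia.
Require Import Defs.
Import ListNotations.
Local Open Scope fm_scope.

Lemma ren_ext (p : form) : forall r s, (forall n, r n = s n) -> ren r p = ren s p.
Proof.
  assert (up_ext : forall r s, (forall n, r n = s n) -> forall n,
    scons 0 (fun m => S (r m)) n = scons 0 (fun m => S (s m)) n)
    by (intros r s E [|n]; cbn; congruence).
  induction p; intros r s E; cbn; f_equal; auto.
Qed.

Lemma ren_ren (p : form) : forall r s, ren r (ren s p) = ren (fun n => r (s n)) p.
Proof.
  induction p; intros r s; cbn; f_equal; auto;
    rewrite IHp; apply ren_ext; intros [|n]; reflexivity.
Qed.

(** Only the shift of the parameters depends on the depth, and [r] turns the shift by [d] into that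
    by [d']; past the arguments, [nth] returns its default, the shifted parameter. *)
Lemma ren_inst (p : form) (args args' : list nat) (d d' : nat) (r : nat -> nat) :
  map r args = args' -> (forall n, r (n + d) = n + d') ->
  ren r (inst p args d) = inst p args' d'.
Proof.
  intros <- E; unfold inst; rewrite ren_ren.
  apply ren_ext; intros n; rewrite length_map.
  destruct (Nat.lt_ge_cases n (length args)) as [lt_n | ge_n].
  - rewrite (nth_indep (map r args) _ (r (n - length args + d))) by (rewrite length_map; exact lt_n).
    symmetry; apply map_nth.
  - rewrite !nth_overflow by (rewrite ?length_map; exact ge_n); apply E.
Qed.

(** The variable bound by the quantifier that lies under [i] quantifiers. *)
Definition var (i : nat) : tm := fun d => d - S i.

(** A context is a list of [fm]s, so that it is shifted under a quantifier by
    evaluating it at the next depth. *)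
Definition entails (T : form -> Prop) (k : nat) (H : list fm) (p : fm) : Prop :=
  prv T (map (fun f => f k) H) (p k).

Section Rules.
Context {T : form -> Prop} {k : nat} {H : list fm}.

Lemma hyp (p : fm) : In p H -> entails T k H p.
Proof. intros i; apply Hyp, (in_map (fun f => f k)), i. Qed.

Lemma and_intro (p q : fm) :
  entails T k H p -> entails T k H q -> entails T k H (p ∧ q).
Proof. apply AndI. Qed.

Lemma and_left (p q : fm) : entails T k H (p ∧ q) -> entails T k H p.
Proof. apply AndE1. Qed.

Lemma and_right (p q : fm) : entails T k H (p ∧ q) -> entails T k H q.
Proof. apply AndE2. Qed.

Lemma imp_intro (p q : fm) : entails T k (p :: H) q -> entails T k H (p ⇒ q).
Proof. apply ImpI. Qed.

Lemma imp_elim (p q : fm) :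
  entails T k H p -> entails T k H (p ⇒ q) -> entails T k H q.
Proof. intros h1 h2; exact (ImpE _ _ _ _ h2 h1). Qed.

Lemma cut (p q : fm) :
  entails T k H p -> entails T k (p :: H) q -> entails T k H q.
Proof. intros h1 h2; exact (imp_elim p q h1 (imp_intro p q h2)). Qed.

(** An [fm] is an arbitrary function of the depth, so its compatibility with shifting has to be
    assumed. *)
Lemma all_intro (p : tm -> fm) :
  map (ren S) (map (fun f => f k) H) = map (fun f => f (S k)) H ->
  entails T (S k) H (p (var k)) -> entails T k H (f_all p).
Proof. intros E h; apply AllI; rewrite E; exact h. Qed.

Lemma all_elim (t : tm) (p : tm -> fm) :
  subst0 (t k) (p (var k) (S k)) = p t k ->
  entails T k H (f_all p) -> entails T k H (p t).
Proof. unfold entails; intros E h; rewrite <- E; exact (AllE _ _ _ _ h). Qed.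

Lemma ex_intro (t : tm) (p : tm -> fm) :
  subst0 (t k) (p (var k) (S k)) = p t k ->
  entails T k H (p t) -> entails T k H (f_ex p).
Proof. unfold entails; intros E h; apply (ExI _ _ _ (t k)); fold (var k); rewrite E; exact h. Qed.

Lemma ex_elim (p : tm -> fm) (q : fm) :
  map (ren S) (map (fun f => f k) H) = map (fun f => f (S k)) H ->
  ren S (q k) = q (S k) ->
  entails T k H (f_ex p) -> entails T (S k) (p (var k) :: H) q -> entails T k H q.
Proof.
  intros E1 E2 h1 h2; refine (ExE _ _ _ _ h1 _); rewrite E1, E2; exact h2.
Qed.

Lemma eq_elim (x y : tm) (p : tm -> fm) :
  subst0 (x k) (p (var k) (S k)) = p x k ->
  subst0 (y k) (p (var k) (S k)) = p y k ->
  entails T k H (x ≈ y) -> entails T k H (p x) -> entails T k H (p y).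
Proof.
  unfold entails; intros Ex Ey; rewrite <- Ex, <- Ey; apply EqE.
Qed.

End Rules.

(** Decides the renaming side conditions of the quantifier rules at a numeral
    depth, where everything but the parameters of [L], [le] and [G] computes. *)
Ltac stable :=
  cbv -[inst ren Nat.add Nat.sub]; cbn -[inst];
  repeat first [ reflexivity
    | apply ren_inst;
      [ reflexivity
      | intros n; rewrite !(Nat.add_comm n); destruct n; cbn; lia ]
    | progress f_equal ].

Ltac in_context :=
  match goal with
  | |- In ?p (?q :: _) => constr_eq p q; apply in_eq
  | |- _ => apply in_cons; in_context
  end.
Ltac by_hyp := first [ assumption | apply hyp; in_context ].
Ltac intro_all := apply all_intro; [ stable | ].

(** [get h p] makes the element [p] of the object-level context available as
    the Rocq hypothesis [h]; [put h] moves [h] to that context, where it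
    survives [intro_all] and [ex_destruct]. *)
Tactic Notation "get" ident(h) constr(p) :=
  match goal with |- entails ?T ?k ?H _ =>
    assert (h : entails T k H p) by by_hyp end.
Tactic Notation "claim" ident(h) constr(p) :=
  match goal with |- entails ?T ?k ?H _ =>
    assert (h : entails T k H p) end.
Ltac put h := apply (cut _ _ h); clear h.
Ltac spec h t := apply (all_elim t) in h; [ cbv beta in h | stable ].
Ltac mp h := eapply imp_elim in h; [ | by_hyp ].
Ltac mps h := repeat mp h.
Ltac fst h := apply and_left in h.
Ltac snd h := apply and_right in h.
Ltac ex_destruct h :=
  refine (ex_elim _ _ _ _ h _); [ stable | stable | cbv beta; clear h ].

Definition generators (L le : form) (B x d : tm) : fm :=
  (∀ b, b ∈ d ⇔ b ∈ B ∧ app2 le b x) ∧ is_sup (app1 L) (app2 le) x d.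

Definition generates (L le : form) (B : tm) : fm :=
  subset_of B (app1 L) ∧ (∀ x, app1 L x ⇒ ∃ d, generators L le B x d).

Definition value (L G : form) (x y : tm) : fm :=
  (app1 L y ∧ app2 G x y) ∧ (∀ z, app1 L z ⇒ app2 G x z ⇒ z ≈ y).

(** Here [w] is the value at [z]; it is quantified because the operator is given by its graph. *)
Definition below_prefixed (L le G : form) (b : tm) : fm :=
  ∀ z, ∀ w, app1 L z ⇒ app1 L w ⇒ app2 G z w ⇒ app2 le w z ⇒ app2 le b z.

Definition separates (L le G : form) (I B : tm) : fm :=
  ∀ b, b ∈ I ⇔ b ∈ B ∧ below_prefixed L le G b.

(** At depth 1, [var 0] is index 0, the argument slot of [app1]. The separating formula quantifies
    over a class, hence the unrestricted scheme. *)
Lemma separation_below_prefixed (L le G : form) :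
  entails CZFm_Sep 0 [] (∀ B, ∃ I, separates L le G I B).
Proof.
  assert (E : toplevel (separation (app1 (below_prefixed L le G (var 0) 1)))
              = toplevel (∀ B, ∃ I, separates L le G I B)).
  { unfold app1 at 1, inst at 1; stable. }
  unfold entails; cbn [map]; fold (toplevel (∀ B, ∃ I, separates L le G I B)).
  rewrite <- E; apply Ax, ax_sep.
Qed.

Theorem corollary4p5 (L le G : form) :
  prv CZFm_Sep nil (toplevel (lfp_statement (app1 L) (app2 le) (app2 G))).
Proof.
  (* [var 0] = B, [var 1] = I,
     [var 2] = x = ⋁ I, [var 3] = y = Γ x, [var 4] = w = Γ y. *)
  change (entails CZFm_Sep 0 [] (lfp_statement (app1 L) (app2 le) (app2 G))).
  (* This has to come first, while the context is still empty. *)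
  pose proof (separation_below_prefixed L le G) as sep; put sep.
  do 3 apply imp_intro.
  claim gen (∃ B, generates L le B).
  { apply (hyp (set_generated (app1 L) (app2 le))); in_context. }
  ex_destruct gen.
  get sep (∀ B, ∃ I, separates L le G I B); spec sep (var 0); ex_destruct sep.
  claim IL (subset_of (var 1) (app1 L)).
  { intro_all; apply imp_intro.
    get bI (separates L le G (var 1) (var 0)); spec bI (var 2).
    fst bI; mp bI; fst bI.
    get BL (generates L le (var 0)); fst BL; spec BL (var 2); mp BL; by_hyp. }
  get sups (sup_semilattice (app1 L) (app2 le)); snd sups; spec sups (var 1); mp sups.
  clear IL; ex_destruct sups.
  get Lx (is_sup (app1 L) (app2 le) (var 2) (var 1)); fst Lx; put Lx.
  (* Within this claim, [var 3] is a prefixed z, [var 4] its value and [var 5] a member of I. *)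
  claim lfx (below_prefixed L le G (var 2)).
  { do 2 intro_all; do 4 apply imp_intro.
    get lub (is_sup (app1 L) (app2 le) (var 2) (var 1)); do 2 snd lub.
    spec lub (var 3); mp lub; refine (imp_elim _ _ _ lub); clear lub.
    intro_all; apply imp_intro.
    get bI (separates L le G (var 1) (var 0)); spec bI (var 5).
    fst bI; mp bI; snd bI; spec bI (var 3); spec bI (var 4); mps bI; by_hyp. }
  put lfx.
  claim total (∀ x, app1 L x ⇒ ∃ y, value L G x y).
  { get mono (monotone_operator (app1 L) (app2 le) (app2 G)); fst mono; exact mono. }
  put total.
  get y (∀ x, app1 L x ⇒ ∃ y, value L G x y); spec y (var 2); mp y.
  ex_destruct y.
  get Ly (value L G (var 2) (var 3)).
  fst Ly; fst Ly; put Ly.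
  get Gxy (value L G (var 2) (var 3)).
  fst Gxy; snd Gxy; put Gxy.
  (* The value of y is needed to express that y is prefixed. *)
  get w (∀ x, app1 L x ⇒ ∃ y, value L G x y); spec w (var 3); mp w.
  ex_destruct w.
  get Lw (value L G (var 3) (var 4)).
  fst Lw; fst Lw; put Lw.
  get Gyw (value L G (var 3) (var 4)).
  fst Gyw; snd Gyw; put Gyw.
  (* Within this claim, [var 5] is the set of generators below y, and [var 6] one of them. *)
  claim yx (app2 le (var 3) (var 2)).
  { get d (generates L le (var 0)); snd d; spec d (var 3); mp d; ex_destruct d.
    get lub (generators L le (var 0) (var 3) (var 5)).
    do 3 snd lub; spec lub (var 2); mp lub; refine (imp_elim _ _ _ lub); clear lub.
    intro_all; apply imp_intro.
    get bd (generators L le (var 0) (var 3) (var 5)).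
    fst bd; spec bd (var 6); fst bd; mp bd; put bd.
    get Bb (var 6 ∈ var 0 ∧ app2 le (var 6) (var 3)); fst Bb; put Bb.
    get b_le (var 6 ∈ var 0 ∧ app2 le (var 6) (var 3)); snd b_le; put b_le.
    get Lb (generates L le (var 0)); fst Lb; spec Lb (var 6); mp Lb; put Lb.
    claim b_low (below_prefixed L le G (var 6)).
    { do 2 intro_all; do 4 apply imp_intro.
      (* With z = [var 7] and Γ z = [var 8], the chain is b ≤ y = Γ x ≤ Γ z ≤ z. *)
      get xz (below_prefixed L le G (var 2)); spec xz (var 7); spec xz (var 8); mps xz.
      get yw (monotone_operator (app1 L) (app2 le) (app2 G)); snd yw.
      spec yw (var 2); spec yw (var 7); spec yw (var 3); spec yw (var 8); mps yw.
      get bw (sup_semilattice (app1 L) (app2 le)); fst bw; snd bw; fst bw.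
      pose proof bw as bz.
      spec bw (var 6); spec bw (var 3); spec bw (var 8); mps bw.
      spec bz (var 6); spec bz (var 8); spec bz (var 7); mps bz; by_hyp. }
    get bI (separates L le G (var 1) (var 0)); spec bI (var 6); snd bI.
    eapply imp_elim in bI; [ | apply and_intro; by_hyp ].
    get ub (is_sup (app1 L) (app2 le) (var 2) (var 1)); snd ub; fst ub.
    spec ub (var 6); mp ub; by_hyp. }
  (* Monotonicity turns y ≤ x into w ≤ y, so y is prefixed and x ≤ y. *)
  get wy (monotone_operator (app1 L) (app2 le) (app2 G)); snd wy.
  spec wy (var 3); spec wy (var 2); spec wy (var 4); spec wy (var 3); mps wy.
  get xy (below_prefixed L le G (var 2)); spec xy (var 3); spec xy (var 4); mps xy.
  get xy_eq (sup_semilattice (app1 L) (app2 le)); fst xy_eq; do 2 snd xy_eq.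
  spec xy_eq (var 3); spec xy_eq (var 2); mps xy_eq.
  claim Gxx (app2 G (var 2) (var 2)).
  { apply (eq_elim (var 3) (var 2) (fun t => app2 G (var 2) t)); [stable | stable | by_hyp ..]. }
  apply (ex_intro (var 2)); [stable | ].
  apply and_intro; [apply and_intro; by_hyp | ].
  intro_all; apply imp_intro.
  get Lu (fixed_point (app1 L) (app2 G) (var 5)); fst Lu.
  get Guu (fixed_point (app1 L) (app2 G) (var 5)); snd Guu.
  get uu (sup_semilattice (app1 L) (app2 le)); fst uu; fst uu; spec uu (var 5); mp uu.
  (* A fixed point is prefixed with itself as value, so z and w are both [var 5]. *)
  get xu (below_prefixed L le G (var 2)); spec xu (var 5); spec xu (var 5); mps xu; by_hyp.
Qed.
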